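(* There is a universal constant $\epsilon>0$ such that the following holds. Let $X$ be a set of $2n$ variables, $\mathbb{F}$ a field, and $f\in\mathbb{F}[X]$ a full max-rank polynomial. Let $\Phi$ be any $(s,d)$-product-sparse formula over $X$ of size at most $n^{\epsilon\log n}$. If $sd=o(n^{1/8})$, then (for all sufficiently large $n$) $\Phi$ does not compute $f$.
   Context: Polynomial coefficient matrix: for disjoint sets of variables $Y,Z$ and $f\in\mathbb{F}[Y,Z]$, $M_f$ is the matrix with rows indexed by monic multilinear monomials $p$ in $Y$ and columns by monic multilinear monomials $q$ in $Z$, with entries in $\mathbb{F}[Y,Z]$: $M_f(p,q)=G$ where $f$ is uniquely written as $f=pq\,G+Q$ with $G$ containing only variables appearing in $pq$ and $Q$ having no monomial that is divisible by $pq$ and contains only variables appearing in $pq$ (equivalently, $G=\sum m/(pq)$ over the terms $m$ of $f$ whose set of occurring variables is exactly the set of variables of $pq$). For $S:Y\cup Z\to\mathbb{F}$, $M_f|_S$ is the matrix obtained by evaluating every entry at $S$, and $\mathrm{maxrank}(M_f)=\max_S\mathrm{rank}(M_f|_S)$. For $X=\{x_1,\dots,x_{2n}\}$, $Y=\{y_1,\dots,y_n\}$, $Z=\{z_1,\dots,z_n\}$, a polynomial $f\in\mathbb{F}[X]$ is full max-rank if for every bijection (partition) $A:X\to Y\cup Z$, $\mathrm{maxrank}(M_{f^A})=2^n$, where $f^A$ is obtained by substituting $A(x)$ for each $x$. Formulas: an arithmetic formula is an arithmetic circuit (fan-in at most 2, leaves labelled by variables or constants) whose underlying graph is a tree; its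 size is its number of gates. For a gate $v$, $X_v$ is the set of variables appearing in the subformula rooted at $v$. A product gate $v$ with children $v_1,v_2$ is disjoint if $X_{v_1}\cap X_{v_2}=\emptyset$, and $s$-sparse if the polynomial computed by at least one of $v_1,v_2$ has at most $2^s$ monomials. The product-sparse depth of a node $v$ is the maximum number of non-disjoint product gates on any path from a leaf to $v$. A formula is $(s,d)$-product-sparse if every product gate is disjoint or $s$-sparse, and $d$ is the product-sparse depth of the root. *)

(* Defs.v *)
From Stdlib Require Import Reals.
From HB Require Import structures.
From mathcomp Require Import all_boot all_order all_algebra all_fingroup.
From mathcomp Require Import mpoly.

Set Implicit Arguments.
Unset Strict Implicit.
Unset Printing Implicit Defensive.

Import GRing.Theory.
Local Open Scope ring_scope.

Inductive formula (F : Type) (k : nat) : Type :=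
| FVar   of 'I_k
| FConst of F
| FAdd   of formula F k & formula F k
| FMul   of formula F k & formula F k.

Arguments FVar {F k}.
Arguments FConst {F k}.
Arguments FAdd {F k}.
Arguments FMul {F k}.

Section Formulas.
Variables (F : nzRingType) (k : nat).

Fixpoint fsize (phi : formula F k) : nat :=
  match phi with
  | FVar _ | FConst _ => 1
  | FAdd a b | FMul a b => (fsize a + fsize b).+1
  end.

Fixpoint fvars (phi : formula F k) : {set 'I_k} :=
  match phi with
  | FVar i => [set i]
  | FConst _ => set0
  | FAdd a b | FMul a b => fvars a :|: fvars b
  end.

Fixpoint feval (phi : formula F k) : {mpoly F[k]} :=
  match phi with
  | FVar i => 'X_i
  | FConst c => c%:MP
  | FAdd a b => feval a + feval b
  | FMul a b => feval a * feval b
  end.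

Definition disjoint_prod (a b : formula F k) : bool :=
  fvars a :&: fvars b == set0.

Definition sparse_prod (s : nat) (a b : formula F k) : bool :=
  (size (msupp (feval a)) <= 2 ^ s)%N || (size (msupp (feval b)) <= 2 ^ s)%N.

Fixpoint ps_depth (phi : formula F k) : nat :=
  match phi with
  | FVar _ | FConst _ => 0%N
  | FAdd a b => maxn (ps_depth a) (ps_depth b)
  | FMul a b => (maxn (ps_depth a) (ps_depth b) + ~~ disjoint_prod a b)%N
  end.

Fixpoint all_prods_ok (s : nat) (phi : formula F k) : Prop :=
  match phi with
  | FVar _ | FConst _ => True
  | FAdd a b => all_prods_ok s a /\ all_prods_ok s b
  | FMul a b => (disjoint_prod a b || sparse_prod s a b)
                /\ all_prods_ok s a /\ all_prods_ok s b
  end.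

Definition product_sparse (s d : nat) (phi : formula F k) : Prop :=
  all_prods_ok s phi /\ ps_depth phi = d.

End Formulas.

(* Polynomial coefficient matrix.  Y \cup Z is indexed by 'I_(n+n):       *)
(* y_i = lshift n i, z_j = rshift n j.  Rows: monic multilinear monomials *)
(* in Y = subsets P of 'I_n; columns: subsets Q of 'I_n (for Z).          *)
Section CoefMatrix.
Variables (F : fieldType) (n : nat).

Definition mvars k (m : 'X_{1..k}) : {set 'I_k} := [set i | m i != 0%N].

Definition setmon k (A : {set 'I_k}) : 'X_{1..k} :=
  [multinom (nat_of_bool (i \in A)) | i < k].

Definition PQset (P Q : {set 'I_n}) : {set 'I_(n + n)} :=
  (@lshift n n) @: P :|: (@rshift n n) @: Q.

Definition coef_entry (g : {mpoly F[n + n]}) (P Q : {set 'I_n}) : {mpoly F[n + n]} :=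
  \sum_(m <- msupp g | mvars m == PQset P Q)
     g@_m *: 'X_[mnm_sub m (setmon (PQset P Q))].

Definition coef_matrix (g : {mpoly F[n + n]}) :
  'M[{mpoly F[n + n]}]_(#|{set 'I_n}|, #|{set 'I_n}|) :=
  \matrix_(i, j) coef_entry g (enum_val i) (enum_val j).

Definition coef_matrix_at (g : {mpoly F[n + n]}) (S : 'I_(n + n) -> F) :
  'M[F]_(#|{set 'I_n}|, #|{set 'I_n}|) :=
  map_mx (fun e => e.@[S]) (coef_matrix g).

Definition maxrank_is (g : {mpoly F[n + n]}) (r : nat) : Prop :=
  (exists S, \rank (coef_matrix_at g S) = r) /\
  (forall S, (\rank (coef_matrix_at g S) <= r)%N).

(* f^A : substitute A(x) for x, A a bijection X -> Y \cup Z *)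
Definition rename_poly (A : {perm 'I_(n + n)}) (f : {mpoly F[n + n]}) :
  {mpoly F[n + n]} :=
  comp_mpoly [tuple 'X_(A i) | i < n + n] f.

Definition full_max_rank (f : {mpoly F[n + n]}) : Prop :=
  forall A : {perm 'I_(n + n)}, maxrank_is (rename_poly A f) (2 ^ n).

End CoefMatrix.

Definition Rpositive (x : R) : Prop := Rlt 0 x.

Definition size_bound (eps : R) (n : nat) : R :=
  Rpower (INR n) (Rmult eps (ln (INR n))).

Definition size_at_most {F : nzRingType} {k : nat} (phi : formula F k) (b : R) : Prop :=
  Rle (INR (fsize phi)) b.

Definition sd_little_o (s d : nat -> nat) : Prop :=
  Un_cv (fun n => Rdiv (INR (s n * d n)) (Rpower (INR n) (Rdiv 1 8))) 0.

(* Main.v *)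
(* At a point [S], the coefficient matrix of a product of two polynomials is
   [L *m (M_g (x) M_h) *m R] for fixed [L] and [R], whether or not [g] and [h]
   share variables; hence the rank is submultiplicative over every product gate,
   and a polynomial with [r] monomials has rank at most [r].  A gate whose
   variables split with imbalance [K] loses a factor [2 ^ (K / 2)] against the
   trivial bound [2 ^ (|X_v| / 2)], and so does a child with less than half of
   the variables of its parent.  Hence, up to the factor
   [fsize * 2 ^ (s * depth)], the formula keeps that loss unless a path of
   balanced gates, each with at least half of the variables of its parent, leads
   down to a small gate.  Colour the variables by independent fair coins: along
   such a path the variable sets shrink through about [log n] scales, and by
   anticoncentration of the binomial law each scale is balanced with probability
   at most [1 / Q], independently of the coins below it.  A union bound over
   paths gives [fsize * Q ^ (- log n)], which is less than the probability
   [1 / (2 n + 1)] that the colouring is an exact partition.  With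
   [n ~ 2 ^ (8 h)] one takes [K = Q = 2 ^ h] and stops at [2 ^ (4 h + 1)]
   variables. *)

Require Import Defs.
From Stdlib Require Import Reals Lra.
From mathcomp Require Import all_boot all_order all_algebra all_fingroup.
From mathcomp Require Import mpoly zify ring.

Set Implicit Arguments.
Unset Strict Implicit.
Unset Printing Implicit Defensive.

(** * Rank of matrices indexed by a finite type *)

Section KernelRank.
Import GRing.Theory.
Local Open Scope ring_scope.
Variables (F : fieldType) (T : finType).
Implicit Types e : T -> T -> F.

Definition kernel_mx e : 'M[F]_(#|T|, #|T|) :=
  \matrix_(i, j) e (enum_val i) (enum_val j).

Definition krank e : nat := \rank (kernel_mx e).

Lemma eq_krank e e' : e =2 e' -> krank e = krank e'.
Proof. by move=> ee; congr mxrank; apply/matrixP=> i j; rewrite !mxE ee. Qed.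

Lemma krankD e e' : (krank (fun P Q => e P Q + e' P Q)%R <= krank e + krank e')%N.
Proof.
apply: leq_trans (mxrank_add _ _); rewrite leq_eqVlt; apply/orP; left.
by apply/eqP; congr mxrank; apply/matrixP=> i j; rewrite !mxE.
Qed.

Lemma krank0 : krank (fun _ _ => 0) = 0%N.
Proof.
by apply/eqP; rewrite mxrank_eq0; apply/eqP/matrixP=> i j; rewrite !mxE.
Qed.

Lemma krank_sum (I : Type) (r : seq I) (E : I -> T -> T -> F) (B : nat) :
  (forall i, krank (E i) <= B)%N ->
  (krank (fun P Q => \sum_(i <- r) E i P Q)%R <= size r * B)%N.
Proof.
move=> EB; elim: r => [|x r IH].
  by rewrite (@eq_krank _ (fun _ _ => 0)) ?krank0 // => P Q; rewrite big_nil.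
rewrite (@eq_krank _ (fun P Q => E x P Q + \sum_(i <- r) E i P Q)); last first.
  by move=> P Q; rewrite big_cons.
by apply: leq_trans (krankD _ _) _; rewrite /= mulSn leq_add.
Qed.

Lemma krank_tr e : krank (fun P Q => e Q P) = krank e.
Proof.
by rewrite /krank -mxrank_tr; congr mxrank; apply/matrixP=> i j; rewrite !mxE.
Qed.

Lemma krank_sandwich (u v : T -> T -> F) e :
  (krank (fun P Q => \sum_P1 \sum_Q1 u P P1 * e P1 Q1 * v Q Q1)%R <= krank e)%N.
Proof.
have -> : krank (fun P Q => \sum_P1 \sum_Q1 u P P1 * e P1 Q1 * v Q Q1) =
   \rank (kernel_mx u *m kernel_mx e *m (kernel_mx v)^T).
  congr mxrank; apply/matrixP=> i j; rewrite !mxE.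
  rewrite exchange_big (reindex _ (onW_bij _ (@enum_val_bij T))) /=.
  apply: eq_bigr => k _; rewrite !mxE mulr_suml.
  rewrite (reindex _ (onW_bij _ (@enum_val_bij T))) /=.
  by apply: eq_bigr => l _; rewrite !mxE.
by apply: leq_trans (mxrankM_maxl _ _) (mxrankM_maxr _ _).
Qed.

(** The matrix factors through its rows in [D], with a 0-1 selection matrix on the left. *)
Lemma krank_rows (D : {set T}) e :
  (forall P Q, P \notin D -> e P Q = 0) -> (krank e <= #|D|)%N.
Proof.
move=> e0.
pose A : 'M[F]_(#|T|, #|D|) := \matrix_(i, k) (enum_val i == enum_val k)%:R.
pose B : 'M[F]_(#|D|, #|T|) := \matrix_(k, j) e (enum_val k) (enum_val j).
suff -> : krank e = \rank (A *m B) by rewrite mulmx_max_rank.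
congr mxrank; apply/matrixP=> i j; rewrite !mxE.
under eq_bigr => k _ do rewrite !mxE.
rewrite -(big_enum_val (fun P => (enum_val i == P)%:R * e P (enum_val j))) /=.
have [iD|iD] := boolP (enum_val i \in D).
  rewrite (bigD1 _ iD) /= eqxx mul1r big1 ?addr0 // => P /andP[_ /negPf].
  by rewrite eq_sym => ->; rewrite mul0r.
rewrite e0 // big1 // => P PD; case: eqP => [iP|]; last by rewrite mul0r.
by rewrite iP PD in iD.
Qed.

Lemma krank_factor e :
  exists a b : 'I_(krank e) -> T -> F, forall P Q, e P Q = \sum_i a i P * b i Q.
Proof.
exists (fun k P => col_base (kernel_mx e) (enum_rank P) k).
exists (fun k Q => row_base (kernel_mx e) k (enum_rank Q)) => P Q.
have := congr1 (fun M : 'M__ => M (enum_rank P) (enum_rank Q)) (mulmx_base (kernel_mx e)).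
by rewrite /kernel_mx !mxE !enum_rankK => <-.
Qed.

(* The kernel below is [L *m (e1 (x) e2) *m R]; a rank factorisation of [e1]
   splits it into [krank e1] sandwiches of [e2]. *)
Lemma krank_conv (u v : T -> T -> T -> F) e1 e2 :
  (krank (fun P Q => \sum_P1 \sum_P2 \sum_Q1 \sum_Q2
     (u P P1 P2 * v Q Q1 Q2) * (e1 P1 Q1 * e2 P2 Q2))%R <= krank e1 * krank e2)%N.
Proof.
have [a [b e1E]] := krank_factor e1.
pose E (i : 'I_(krank e1)) P Q := \sum_P2 \sum_Q2
  (\sum_P1 u P P1 P2 * a i P1) * e2 P2 Q2 * (\sum_Q1 v Q Q1 Q2 * b i Q1).
rewrite (@eq_krank _ (fun P Q => \sum_(i <- index_enum 'I_(krank e1)) E i P Q)).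
  apply: leq_trans (krank_sum _ (fun i => krank_sandwich _ _ _)) _.
  rewrite leq_mul2r; apply/orP; right.
  have -> // : size (index_enum 'I_(krank e1)) = krank e1.
  by rewrite -[RHS]card_ord cardT enumT.
move=> P Q; rewrite exchange_big /E [RHS]exchange_big /=; apply: eq_bigr => P2 _.
rewrite [RHS]exchange_big /=.
under eq_bigr => P1 _ do rewrite exchange_big /=.
rewrite exchange_big /=; apply: eq_bigr => Q2 _.
transitivity (\sum_(i < krank e1) \sum_P1 \sum_Q1
    u P P1 P2 * a i P1 * e2 P2 Q2 * (v Q Q1 Q2 * b i Q1)); last first.
  apply: eq_bigr => i _; rewrite !mulr_suml.
  by apply: eq_bigr => P1 _; rewrite mulr_sumr.
rewrite [RHS]exchange_big /=; apply: eq_bigr => P1 _.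
rewrite [RHS]exchange_big /=; apply: eq_bigr => Q1 _.
rewrite e1E mulr_suml mulr_sumr; apply: eq_bigr => i _; ring.
Qed.

End KernelRank.

(** * Coefficient matrices at a point *)

Section CoefKernel.
Import GRing.Theory.
Local Open Scope ring_scope.
Variables (F : fieldType) (n : nat) (S : 'I_(n + n) -> F).
Implicit Types (io : 'I_n -> 'I_(n + n)) (m : 'X_{1..n + n}) (P Q : {set 'I_n}).
Implicit Types g h : {mpoly F[n + n]}.

Definition trace io m : {set 'I_n} := [set i | m (io i) != 0%N].

(** The share of one side, Y or Z, in the entry produced by [m]: the monomial is divided once by
    each of its variables. Since [0.-1 = 0], absent variables contribute 1. *)
Definition weight io P m : F :=
  (trace io m == P)%:R * \prod_i S (io i) ^+ (m (io i)).-1.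

Definition coef_kernel g P Q : F :=
  \sum_(m <- msupp g) g@_m * (weight (@lshift n n) P m * weight (@rshift n n) Q m).

Lemma mvars_PQset m P Q :
  (mvars m == PQset P Q) = (trace (@lshift n n) m == P) && (trace (@rshift n n) m == Q).
Proof.
have inl i : (lshift n i \in PQset P Q) = (i \in P).
  rewrite inE mem_imset; last exact: lshift_inj.
  by rewrite orbC; case: imsetP => //= -[j _ /eqP]; rewrite eq_lrshift.
have inr i : (rshift n i \in PQset P Q) = (i \in Q).
  rewrite inE orbC mem_imset; last exact: rshift_inj.
  by rewrite orbC; case: imsetP => //= -[j _ /eqP]; rewrite eq_rlshift.
apply/eqP/andP => [mPQ|[/eqP mP /eqP mQ]].
  by split; apply/eqP/setP=> i; rewrite inE -?inl -?inr -mPQ inE.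
apply/setP=> i; rewrite -(splitK i); case: (split i) => j /=.
  by rewrite inl -mP !inE.
by rewrite inr -mQ !inE.
Qed.

Lemma coef_entryE g P Q : (coef_entry g P Q).@[S] = coef_kernel g P Q.
Proof.
rewrite /coef_entry raddf_sum big_mkcond /=; apply: eq_bigr => m _.
rewrite /weight mvars_PQset mevalZ mevalX; case: eqP => [mP|] /=; last first.
  by rewrite !(mul0r, mulr0).
case: eqP => [mQ|] /=; last by rewrite !(mul0r, mulr0).
rewrite !mul1r big_split_ord /=; congr (_ * (_ * _)); apply: eq_bigr => i _;
  congr (_ ^+ _); rewrite mnmBE mnmE -mP -mQ;
  have /eqP <- : mvars m == PQset (trace (@lshift n n) m) (trace (@rshift n n) m)
    by rewrite mvars_PQset !eqxx.
all: by rewrite inE; case: (m _) => //= k; rewrite subn1.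
Qed.

(** Summing over all monomials of bounded degree frees the index set from the support of [g], so
    that linearity can be checked term by term. *)
Lemma coef_kernelw k g P Q : (msize g <= k)%N -> coef_kernel g P Q =
  \sum_(m : 'X_{1..(n + n) < k}) g@_m *
    (weight (@lshift n n) P m * weight (@rshift n n) Q m).
Proof.
move=> lt_gk; pose I : subFinType _ := 'X_{1..(n + n) < k}.
rewrite /coef_kernel (ssrcomplements.big_mksub I) //=; first last.
- by move=> x /msize_mdeg_lt /leq_trans; apply.
- by rewrite msupp_uniq.
by rewrite big_rmcond //= => i; move/memN_msupp_eq0 ->; rewrite mul0r.
Qed.

Lemma coef_kernelD g h P Q :
  coef_kernel (g + h) P Q = coef_kernel g P Q + coef_kernel h P Q.
Proof.
pose k := maxn (msize (g + h)) (maxn (msize g) (msize h)).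
rewrite !(@coef_kernelw k) ?leq_max ?leqnn ?orbT // -big_split /=.
by apply: eq_bigr => m _; rewrite mcoeffD mulrDl.
Qed.

Lemma coef_kernelZ c g P Q : coef_kernel (c *: g) P Q = c * coef_kernel g P Q.
Proof.
pose k := maxn (msize (c *: g)) (msize g).
rewrite !(@coef_kernelw k) ?leq_max ?leqnn ?orbT // mulr_sumr.
by apply: eq_bigr => m _; rewrite mcoeffZ -mulrA.
Qed.

Lemma coef_kernelX m P Q :
  coef_kernel 'X_[m] P Q = weight (@lshift n n) P m * weight (@rshift n n) Q m.
Proof. by rewrite /coef_kernel msuppX big_seq1 mcoeffX eqxx mul1r. Qed.

Lemma coef_kernel_sum (I : Type) (r : seq I) (E : I -> {mpoly F[n + n]}) P Q :
  coef_kernel (\sum_(i <- r) E i) P Q = \sum_(i <- r) coef_kernel (E i) P Q.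
Proof.
elim: r => [|x r IH]; first by rewrite !big_nil /coef_kernel msupp0 big_nil.
by rewrite !big_cons coef_kernelD IH.
Qed.

(* Each monomial is divided once by each of its variables, so a variable common
   to both factors survives once in the product. *)
Definition overlap io P P1 P2 : F :=
  (P1 :|: P2 == P)%:R * \prod_(i in P1 :&: P2) S (io i).

Lemma weightD io P m1 m2 : weight io P (m1 + m2)%MM =
  \sum_P1 \sum_P2 overlap io P P1 P2 * (weight io P1 m1 * weight io P2 m2).
Proof.
(* Only the pair of traces of [m1] and [m2] gives a nonzero term. *)
rewrite (bigD1 (trace io m1)) //= (bigD1 (trace io m2)) //=.
rewrite [X in _ + X + _]big1 ?addr0 => [|P2 /negPf nP]; last first.
  by rewrite /weight [trace io m2 == P2]eq_sym nP mul0r !mulr0.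
rewrite [X in _ + X]big1 ?addr0 => [|P1 /negPf nP]; last first.
  by apply: big1 => P2 _; rewrite /weight eq_sym nP !mul0r mulr0.
rewrite /weight /overlap !eqxx !mul1r.
have -> : trace io (m1 + m2)%MM = trace io m1 :|: trace io m2.
  by apply/setP=> i; rewrite !inE mnmDE addn_eq0 negb_and.
rewrite -mulrA; congr (_ * _).
rewrite [X in _ = X * _]big_mkcond -!big_split /=; apply: eq_bigr => i _.
(* For exponents [a.+1] and [b.+1] the predecessor of the sum is [a + b + 1]; the extra factor
   [S (io i)] is the one recorded by [overlap]. *)
rewrite mnmDE !inE; case: (m1 (io i)) => [|a]; case: (m2 (io i)) => [|b] //=;
  rewrite ?mul1r ?mulr1 ?expr0 ?addn0 ?addnS ?addSn //=.
by rewrite exprS exprD.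
Qed.

Lemma coef_kernelM g h P Q : coef_kernel (g * h) P Q =
  \sum_P1 \sum_P2 \sum_Q1 \sum_Q2
    (overlap (@lshift n n) P P1 P2 * overlap (@rshift n n) Q Q1 Q2) *
    (coef_kernel g P1 Q1 * coef_kernel h P2 Q2).
Proof.
pose G m1 m2 := \sum_P1 \sum_P2 \sum_Q1 \sum_Q2
    (overlap (@lshift n n) P P1 P2 * overlap (@rshift n n) Q Q1 Q2) *
    ((g@_m1 * (weight (@lshift n n) P1 m1 * weight (@rshift n n) Q1 m1)) *
     (h@_m2 * (weight (@lshift n n) P2 m2 * weight (@rshift n n) Q2 m2))).
transitivity (\sum_(m1 <- msupp g) \sum_(m2 <- msupp h) G m1 m2).
  rewrite mpolyME coef_kernel_sum big_allpairs /=.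
  apply: eq_bigr => m1 _; apply: eq_bigr => m2 _.
  rewrite coef_kernelZ coef_kernelX !weightD mulr_suml mulr_sumr.
  apply: eq_bigr => P1 _; rewrite mulr_suml mulr_sumr.
  apply: eq_bigr => P2 _; rewrite mulr_sumr mulr_sumr.
  apply: eq_bigr => Q1 _; rewrite mulr_sumr mulr_sumr.
  by apply: eq_bigr => Q2 _; ring.
under eq_bigr => m1 _ do rewrite exchange_big /=.
rewrite exchange_big /=; apply: eq_bigr => P1 _.
under eq_bigr => m1 _ do rewrite exchange_big /=.
rewrite exchange_big /=; apply: eq_bigr => P2 _.
under eq_bigr => m1 _ do rewrite exchange_big /=.
rewrite exchange_big /=; apply: eq_bigr => Q1 _.
under eq_bigr => m1 _ do rewrite exchange_big /=.
rewrite exchange_big /=; apply: eq_bigr => Q2 _.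
rewrite /coef_kernel mulr_suml mulr_sumr; apply: eq_bigr => m1 _.
by rewrite mulr_sumr mulr_sumr.
Qed.

Lemma coef_kernelC c P Q :
  coef_kernel c%:MP P Q = c * ((P == set0)%:R * (Q == set0)%:R).
Proof.
rewrite -[c%:MP]mulr1 mul_mpolyC coef_kernelZ -mpolyX0 coef_kernelX; congr (_ * _).
have t0 io : trace io 0%MM = set0 by apply/setP=> i; rewrite !inE mnm0E.
rewrite /weight !t0 ![set0 == _]eq_sym !big1 ?mulr1 // => i _; by rewrite mnm0E.
Qed.

Lemma coef_kernelU i P Q : coef_kernel 'X_i P Q =
  (P == [set j | lshift n j == i])%:R * (Q == [set j | rshift n j == i])%:R.
Proof.
have t0 io : trace io U_(i)%MM = [set j | io j == i].
  by apply/setP=> j; rewrite !inE mnm1E eqb0 negbK eq_sym.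
rewrite coef_kernelX /weight !t0 !big1 ?mulr1 => [|j _|j _].
- by rewrite ![_ == [set j | _]]eq_sym.
- by rewrite mnm1E; case: (_ == _).
by rewrite mnm1E; case: (_ == _).
Qed.

Definition mrank g : nat := \rank (coef_matrix_at g S).

Lemma mrankE g : mrank g = krank (coef_kernel g).
Proof. by congr mxrank; apply/matrixP=> i j; rewrite !mxE coef_entryE. Qed.

Lemma mrankD g h : (mrank (g + h) <= mrank g + mrank h)%N.
Proof.
rewrite !mrankE; apply: leq_trans (krankD _ _).
by rewrite (eq_krank (coef_kernelD g h)).
Qed.

Lemma mrankM g h : (mrank (g * h) <= mrank g * mrank h)%N.
Proof. by rewrite !mrankE (eq_krank (coef_kernelM g h)) krank_conv. Qed.

Lemma mrankC c : (mrank c%:MP <= 1)%N.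
Proof.
rewrite mrankE -(cards1 (set0 : {set 'I_n})); apply: krank_rows => P Q.
by rewrite inE coef_kernelC => /negPf ->; rewrite mul0r mulr0.
Qed.

Lemma mrankU i : (mrank 'X_i <= 1)%N.
Proof.
rewrite mrankE -(cards1 [set j | lshift n j == i]); apply: krank_rows => P Q.
by rewrite inE coef_kernelU => /negPf ->; rewrite mul0r.
Qed.

Lemma mrank_expU i k : (mrank ('X_i ^+ k) <= 1)%N.
Proof.
elim: k => [|k IH]; first exact: mrankC.
rewrite exprS; apply: leq_trans (mrankM _ _) _.
by apply: (@leq_trans (1 * 1)%N); first apply: leq_mul; rewrite ?mrankU.
Qed.

Lemma mrank_monomial (r : seq 'I_(n + n)) (A : 'I_(n + n) -> 'I_(n + n))
    (k : 'I_(n + n) -> nat) : (mrank (\prod_(i <- r) 'X_(A i) ^+ k i) <= 1)%N.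
Proof.
elim: r => [|x r IH]; first by rewrite big_nil -mpolyC1 mrankC.
rewrite big_cons; apply: leq_trans (mrankM _ _) _.
by apply: (@leq_trans (1 * 1)%N); first apply: leq_mul; rewrite ?mrank_expU.
Qed.

(** Renaming sends each monomial to a product of powers of variables, which has rank at most 1; the
    terms are then added up. *)
Lemma mrank_rename_supp (A : {perm 'I_(n + n)}) g :
  (mrank (rename_poly A g) <= size (msupp g))%N.
Proof.
rewrite /rename_poly comp_mpolyE; elim: (msupp g) => [|m r IH].
  rewrite big_nil -mpolyC0 mrankE.
  rewrite (@eq_krank _ _ _ (fun _ _ => 0)) ?krank0 // => P Q.
  by rewrite coef_kernelC mul0r.
rewrite big_cons; apply: leq_trans (mrankD _ _) _; rewrite -[size _]/((1 + size r)%N) leq_add //.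
rewrite -mul_mpolyC; apply: leq_trans (mrankM _ _) _.
apply: (@leq_trans (1 * 1)%N) => //; apply: leq_mul; first exact: mrankC.
under eq_bigr => i _ do rewrite tnth_mktuple.
exact: mrank_monomial.
Qed.

End CoefKernel.

(** * Rank of formulas *)

Section UnbalancedFormulas.
Variables (F : fieldType) (n : nat) (K B : nat).
Implicit Types (phi : formula F (n + n)) (c : {set 'I_(n + n)}).

(** As [#|W|] is the sum of the two parts, this says that their sizes differ by less than [K]. *)
Definition balanced (W c : {set 'I_(n + n)}) : bool :=
  #|W| < 2 * minn #|W :&: c| #|W :\: c| + K.

(* Some path of balanced gates descends from the root to a leaf or to a gate
   with at most [B] variables, never losing more than half of the variables in
   one step. *)
Fixpoint balanced_path phi c : bool :=
  balanced (fvars phi) c &&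
  match phi with
  | FVar _ | FConst _ => true
  | FAdd a b | FMul a b =>
    [|| #|fvars a :|: fvars b| <= B,
        (#|fvars a :|: fvars b| <= 2 * #|fvars a|) && balanced_path a c
      | (#|fvars a :|: fvars b| <= 2 * #|fvars b|) && balanced_path b c]
  end.

Lemma balanced_pathW phi c : balanced_path phi c -> balanced (fvars phi) c.
Proof. by case: phi => [i|e|a b|a b] /= /andP[]. Qed.

Section Rank.
Import GRing.Theory.
Variables (S : 'I_(n + n) -> F) (A : {perm 'I_(n + n)}).

Definition frank phi : nat := mrank S (rename_poly A (feval phi)).

Definition pulled (io : 'I_n -> 'I_(n + n)) (V : {set 'I_(n + n)}) : {set 'I_n} :=
  [set j | (A^-1)%g (io j) \in V].

Lemma pulledU io V W : pulled io (V :|: W) = pulled io V :|: pulled io W.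
Proof. by apply/setP=> j; rewrite !inE. Qed.

Lemma rename_polyU i : rename_poly A ('X_i : {mpoly F[n + n]}) = 'X_(A i).
Proof. by rewrite /rename_poly comp_mpolyXU -tnth_nth tnth_mktuple. Qed.

(** The induction follows the formula, so the support is controlled by the variables that occur in
    it syntactically, whatever cancels in the polynomial. *)
Lemma coef_kernel_supp phi (P Q : {set 'I_n}) :
  ~~ ((P \subset pulled (@lshift n n) (fvars phi)) &&
      (Q \subset pulled (@rshift n n) (fvars phi))) ->
  coef_kernel S (rename_poly A (feval phi)) P Q = 0%R.
Proof.
elim: phi P Q => [i|e|a IHa b IHb|a IHa b IHb] P Q /= PQ.
- rewrite rename_polyU coef_kernelU.
  case: eqP => [PE|]; last by rewrite mul0r.
  case: eqP => [QE|]; last by rewrite mulr0.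
  case/negP: PQ; rewrite PE QE; apply/andP; split; apply/subsetP=> j; rewrite !inE.
    by move/eqP->; rewrite permK.
  by move/eqP->; rewrite permK.
- rewrite /rename_poly comp_mpolyC coef_kernelC.
  case: eqP => [PE|]; last by rewrite mul0r mulr0.
  case: eqP => [QE|]; last by rewrite !mulr0.
  by case/negP: PQ; rewrite PE QE !sub0set.
- rewrite /rename_poly comp_mpolyD coef_kernelD IHa ?IHb ?addr0 //;
    apply: contra PQ => /andP[Pa Qa]; rewrite !pulledU.
    by rewrite (subset_trans Pa (subsetUr _ _)) (subset_trans Qa (subsetUr _ _)).
  by rewrite (subset_trans Pa (subsetUl _ _)) (subset_trans Qa (subsetUl _ _)).
rewrite /rename_poly rmorphM coef_kernelM big1 // => P1 _; rewrite big1 // => P2 _.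
rewrite big1 // => Q1 _; rewrite big1 // => Q2 _; rewrite /overlap.
case: eqP => [PE|]; last by rewrite !mul0r.
case: eqP => [QE|]; last by rewrite mul0r mulr0 mul0r.
case: (boolP ((P1 \subset pulled (@lshift n n) (fvars a)) &&
      (Q1 \subset pulled (@rshift n n) (fvars a)))) => [/andP[Pa Qa]|na]; last first.
  by rewrite [coef_kernel S _ P1 _]IHa // mul0r mulr0.
case: (boolP ((P2 \subset pulled (@lshift n n) (fvars b)) &&
      (Q2 \subset pulled (@rshift n n) (fvars b)))) => [/andP[Pb Qb]|nb]; last first.
  by rewrite [coef_kernel S _ P2 _]IHb // !mulr0.
by case/negP: PQ; rewrite !pulledU -PE -QE !setUSS.
Qed.

(** The variables that [A] sends to the Y side. *)
Let c : {set 'I_(n + n)} := [set i | A i < n].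

Lemma frank_row phi : frank phi <= 2 ^ #|fvars phi :&: c|.
Proof.
rewrite /frank mrankE; have := @krank_rows F _ (powerset (pulled (@lshift n n) (fvars phi)))
  (coef_kernel S (rename_poly A (feval phi))).
rewrite card_powerset => h; apply: leq_trans (h _) _.
  by move=> P Q; rewrite powersetE => /negPf nP; apply: coef_kernel_supp; rewrite nP.
have inj : injective (fun j => (A^-1)%g (@lshift n n j)).
  by apply: inj_comp; [apply: perm_inj | apply: lshift_inj].
rewrite leq_exp2l // -(card_imset _ inj); apply: subset_leq_card.
by apply/subsetP=> _ /imsetP[j + ->]; rewrite !inE => ->; rewrite permKV /=.
Qed.

Lemma frank_col phi : frank phi <= 2 ^ #|fvars phi :\: c|.
Proof.
rewrite /frank mrankE -krank_tr.
have := @krank_rows F _ (powerset (pulled (@rshift n n) (fvars phi)))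
  (fun Q P => coef_kernel S (rename_poly A (feval phi)) P Q).
rewrite card_powerset => h; apply: leq_trans (h _) _.
  move=> Q P; rewrite powersetE => /negPf nQ; apply: coef_kernel_supp.
  by rewrite nQ andbF.
have inj : injective (fun j => (A^-1)%g (@rshift n n j)).
  by apply: inj_comp; [apply: perm_inj | apply: rshift_inj].
rewrite leq_exp2l // -(card_imset _ inj); apply: subset_leq_card.
apply/subsetP=> _ /imsetP[j + ->]; rewrite !inE => ->; rewrite permKV /= andbT.
by rewrite -leqNgt leq_addr.
Qed.

Lemma frank_min phi : frank phi <= 2 ^ minn #|fvars phi :&: c| #|fvars phi :\: c|.
Proof.
by rewrite /minn; case: ifP => _; [apply: frank_row | apply: frank_col].
Qed.

(** Row bound times column bound; squaring avoids the half-integer exponent. *)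
Lemma frank_sqr phi : frank phi ^ 2 <= 2 ^ #|fvars phi|.
Proof.
rewrite -(cardsID c (fvars phi)) expnD -mulnn.
by rewrite leq_mul ?frank_row ?frank_col.
Qed.

Lemma leq_sqrD (x y a b C D : nat) :
  x ^ 2 * C <= a ^ 2 * D -> y ^ 2 * C <= b ^ 2 * D ->
  (x + y) ^ 2 * C <= (a + b) ^ 2 * D.
Proof.
(* The cross term: multiply both hypotheses and take a square root. *)
move=> xa yb; have xy : x * y * C <= a * b * D.
  rewrite -leq_sqr -!mulnn; have := leq_mul xa yb.
  by congr (_ <= _); rewrite -!mulnn; ring.
by rewrite !sqrnD !mulnDl !leq_add // -!mulnA leq_mul2l /=.
Qed.

Lemma leq_sqrM (x y a C D E : nat) :
  x ^ 2 * C <= a ^ 2 * D -> y ^ 2 <= E -> (x * y) ^ 2 * C <= a ^ 2 * (D * E).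
Proof.
move=> xa yE; rewrite expnMn mulnAC [a ^ 2 * _]mulnA; exact: leq_mul.
Qed.

(** The loss [2 ^ K] arises at an unbalanced gate or at a steep drop in variables and is passed
    upward: sums add the size factors, disjoint products keep the loss of the larger factor, other
    products pay [2 ^ s] for the sparse one. *)
Lemma frank_le s phi : 2 * K <= B -> all_prods_ok s phi ->
  ~~ balanced_path phi c ->
  frank phi ^ 2 * 2 ^ K <=
    (fsize phi * 2 ^ (s * ps_depth phi)) ^ 2 * 2 ^ #|fvars phi|.
Proof.
move=> KB.
have unbal psi : ~~ balanced (fvars psi) c -> frank psi ^ 2 * 2 ^ K <=
    (fsize psi * 2 ^ (s * ps_depth psi)) ^ 2 * 2 ^ #|fvars psi|.
  rewrite /balanced -leqNgt => le.
  have p0 : 0 < (fsize psi * 2 ^ (s * ps_depth psi)) ^ 2.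
    by rewrite expn_gt0 muln_gt0 expn_gt0 /=; case: psi {le}.
  apply: leq_trans (leq_pmull _ p0).
  apply: (@leq_trans (2 ^ (2 * minn #|fvars psi :&: c| #|fvars psi :\: c| + K))).
    by rewrite expnD leq_mul2r mulnC expnM leq_sqr frank_min orbT.
  by rewrite leq_exp2l.
(* Seen from a gate with variables [X], a child shows the loss by induction, or because it has fewer
   than half of [X]: then [2 * K <= B < #|X|] makes at least [K] variables missing. *)
have child psi (X : {set 'I_(n + n)}) : fvars psi \subset X ->
    (~~ balanced_path psi c -> frank psi ^ 2 * 2 ^ K <=
      (fsize psi * 2 ^ (s * ps_depth psi)) ^ 2 * 2 ^ #|fvars psi|) ->
    ~~ (#|X| <= B) -> ~~ ((#|X| <= 2 * #|fvars psi|) && balanced_path psi c) ->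
    frank psi ^ 2 * 2 ^ K <= (fsize psi * 2 ^ (s * ps_depth psi)) ^ 2 * 2 ^ #|X|.
  move=> /subset_leq_card sX IH big; rewrite negb_and -ltnNge => /orP[small|nb].
    have p0 : 0 < (fsize psi * 2 ^ (s * ps_depth psi)) ^ 2.
      by rewrite expn_gt0 muln_gt0 expn_gt0 /=; case: psi {sX IH small}.
    apply: leq_trans (leq_pmull _ p0).
    apply: (@leq_trans (2 ^ (#|fvars psi| + K))).
      by rewrite expnD leq_mul2r frank_sqr orbT.
    by rewrite leq_exp2l //; move: big small; lia.
  by apply: leq_trans (IH nb) _; rewrite leq_mul2l leq_exp2l // sX orbT.
elim: phi => [i|e|a IHa b IHb|a IHa b IHb].
- by move=> _ /= nb; apply: unbal; move: nb; rewrite andbT.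
- by move=> _ /= nb; apply: unbal; move: nb; rewrite andbT.
- move=> /= [oka okb]; rewrite negb_and => /orP[nb|]; first exact: (unbal (FAdd a b)).
  rewrite !negb_or => /and3P[big na nb].
  have {IHa}Ha := child a _ (subsetUl _ _) (IHa oka) big na.
  have {IHb}Hb := child b _ (subsetUr _ _) (IHb okb) big nb.
  apply: leq_trans (_ : (frank a + frank b) ^ 2 * 2 ^ K <= _).
    rewrite leq_mul2r leq_sqr /frank /= /rename_poly comp_mpolyD.
    by rewrite mrankD orbT.
  apply: leq_trans (leq_sqrD Ha Hb) _.
  rewrite leq_mul2r leq_sqr; apply/orP; right.
  rewrite mulSn mulnDl; apply: leq_trans (leq_addl _ _).
  by rewrite leq_add // leq_mul2l leq_exp2l // leq_mul2l leq_max leqnn ?orbT.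
move=> /= [ok [oka okb]]; rewrite negb_and => /orP[nb|]; first exact: (unbal (FMul a b)).
rewrite !negb_or => /and3P[big na nb].
have {}Ha := child a _ (subsetUl _ _) (IHa oka) big na.
have {}Hb := child b _ (subsetUr _ _) (IHb okb) big nb.
have fM : frank (FMul a b) <= frank a * frank b.
  by rewrite /frank /= /rename_poly rmorphM mrankM.
apply: leq_trans (_ : (frank a * frank b) ^ 2 * 2 ^ K <= _).
  by rewrite leq_mul2r leq_sqr fM orbT.
pose sz := (fsize a + fsize b).+1; pose dp := maxn (ps_depth a) (ps_depth b).
have grow (u v t w : nat) : u <= t -> v <= w ->
    (u * 2 ^ (s * v)) ^ 2 <= (t * 2 ^ (s * w)) ^ 2.
  by move=> ut vw; rewrite leq_sqr leq_mul // leq_exp2l // leq_mul2l vw orbT.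
have sa : fsize a <= sz by rewrite leqW ?leq_addr.
have sb : fsize b <= sz by rewrite leqW ?leq_addl.
have da : ps_depth a <= dp by rewrite leq_maxl.
have db : ps_depth b <= dp by rewrite leq_maxr.
(* In the disjoint case the larger child has at least half of the variables, hence no balanced path;
   the other child only needs [frank_sqr]. *)
have [dj|ndj] := boolP (disjoint_prod a b).
  have cX : #|fvars a :|: fvars b| = #|fvars a| + #|fvars b|.
    by apply/eqP; rewrite (leq_card_setU _ _) -setI_eq0.
  rewrite addn0; move: na nb; rewrite cX expnD.
  have [ab|/ltnW ba] := leqP #|fvars a| #|fvars b|.
    have -> /= : #|fvars a| + #|fvars b| <= 2 * #|fvars b| by lia.
    move=> _ /(IHb okb) h; rewrite [frank a * _]mulnC [2 ^ #|fvars a| * _]mulnC.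
    apply: leq_trans (leq_sqrM h (frank_sqr a)) _.
    by rewrite leq_mul2r grow ?orbT.
  have -> /= : #|fvars a| + #|fvars b| <= 2 * #|fvars a| by lia.
  move=> /(IHa oka) h _; apply: leq_trans (leq_sqrM h (frank_sqr b)) _.
  by rewrite leq_mul2r grow ?orbT.
have -> : (sz * 2 ^ (s * (dp + 1))) ^ 2 * 2 ^ #|fvars a :|: fvars b| =
    (sz * 2 ^ (s * dp)) ^ 2 * (2 ^ #|fvars a :|: fvars b| * (2 ^ s) ^ 2).
  by rewrite mulnDr muln1 expnD !expnMn; ring.
move: ok; rewrite (negPf ndj) /= => /orP[spa|spb].
  rewrite [frank a * _]mulnC; apply: leq_trans (leq_sqrM Hb (_ : frank a ^ 2 <= (2 ^ s) ^ 2)) _.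
    by rewrite leq_sqr (leq_trans (mrank_rename_supp _ _ _) spa).
  by rewrite leq_mul2r grow ?orbT.
apply: leq_trans (leq_sqrM Ha (_ : frank b ^ 2 <= (2 ^ s) ^ 2)) _.
  by rewrite leq_sqr (leq_trans (mrank_rename_supp _ _ _) spb).
by rewrite leq_mul2r grow ?orbT.
Qed.

End Rank.
End UnbalancedFormulas.

(** * Balanced paths are rare *)

Section CentralBinomial.

Lemma leq_bin_incr m k : 2 * k < m -> 'C(m, k) <= 'C(m, k.+1).
Proof.
move=> km; have := mul_bin_left m k.
rewrite -(leq_pmul2l (ltn0Sn k)) => ->.
by rewrite leq_mul2r; apply/orP; right; lia.
Qed.

Lemma leq_bin_central m k : 'C(m, k) <= 'C(m, m./2).
Proof.
have low i : i <= m./2 -> 'C(m, m./2 - i) <= 'C(m, m./2).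
  elim: i => [|i IH] im; first by rewrite subn0.
  apply: leq_trans (IH (ltnW im)).
  have -> : m./2 - i = (m./2 - i.+1).+1 by lia.
  by apply: leq_bin_incr; lia.
have low' i : i <= m./2 -> 'C(m, i) <= 'C(m, m./2).
  by move=> im; rewrite -{1}(subKn im); apply: low; rewrite leq_subr.
have [km|mk] := leqP k m; last by rewrite bin_small.
have [|ki] := leqP k m./2; first exact: low'.
by rewrite -bin_sub //; apply: low'; lia.
Qed.

Lemma exp4_leq_bin n : 4 ^ n <= (2 * n).+1 * 'C(2 * n, n).
Proof.
have -> : 4 ^ n = \sum_(i < (2 * n).+1) 'C(2 * n, i).
  have := Pascal 1 1 (2 * n); rewrite expnM => ->.
  by apply: eq_bigr => i _; rewrite !exp1n !muln1.
apply: leq_trans (leq_sum _ (fun i _ => leq_bin_central _ _)) _.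
by rewrite sum_nat_const card_ord mul2n doubleK.
Qed.

Lemma bin_double_sqr t : 'C(2 * t, t) ^ 2 * (2 * t).+1 <= 4 ^ (2 * t).
Proof.
elim: t => [|t IH] //.
have E : t.+1 * 'C(2 * t.+1, t.+1) = 2 * (2 * t).+1 * 'C(2 * t, t).
  have e : 'C((2 * t).+1, t) = 'C((2 * t).+1, t.+1).
    by rewrite -[RHS]bin_sub; [congr 'C(_, _) |]; lia.
  have -> : 2 * t.+1 = (2 * t).+2 by lia.
  rewrite binS e addnn -muln2 mulnA -mul_bin_diag /=; lia.
rewrite -(leq_pmul2l (_ : 0 < t.+1 ^ 2)) ?expn_gt0 // mulnA -expnMn E.
have -> : 4 ^ (2 * t.+1) = 16 * 4 ^ (2 * t).
  by rewrite -[in RHS](expnD 4 2); congr (_ ^ _); lia.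
rewrite expnMn.
set c := 'C(2 * t, t) ^ 2 in IH *; set e := 4 ^ _ in IH *.
(* After cancellation this is [(2t + 1)(2t + 3) <= (2t + 2)^2]. *)
have h : (2 * (2 * t).+1) ^ 2 * (2 * t.+1).+1 <= t.+1 ^ 2 * 16 * (2 * t).+1.
  by rewrite -!mulnn; nia.
apply: leq_trans (_ : t.+1 ^ 2 * 16 * (2 * t).+1 * c <= _).
  by rewrite mulnAC leq_mul2r h orbT.
by rewrite mulnA -[_ * _ * c]mulnA leq_mul2l [_ * c]mulnC IH orbT.
Qed.

(** An odd [m] reduces to the even [m.+1], whose central coefficient is twice as large. *)
Lemma bin_central_sqr m : 'C(m, m./2) ^ 2 * m.+1 <= 4 ^ m.
Proof.
have [mo|me] := boolP (odd m); last first.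
  by have := bin_double_sqr m./2; rewrite mul2n halfK (negPf me) subn0.
have := bin_double_sqr m./2.+1.
have E : 2 * m./2.+1 = m.+1 by have := odd_double_half m; rewrite mo; lia.
rewrite E binS.
have -> : 'C(m, m./2.+1) = 'C(m, m./2).
  by rewrite -bin_sub; [congr 'C(_, _) | ]; lia.
rewrite addnn -muln2 expnMn [4 ^ m.+1]expnS.
set y := _ ^ 2; set z := 4 ^ m; nia.
Qed.

End CentralBinomial.

(** * Anticoncentration of the number of coloured elements *)

Section AntiConcentration.
Variable T : finType.
Implicit Types c u v D : {set T}.

Lemma card_sized_window D lo K :
  #|[set v : {set T} | (v \subset D) && (lo <= #|v| < lo + K)]|
  <= K * 'C(#|D|, #|D|./2).
Proof.
elim: K => [|K IH].
  rewrite (_ : [set _ | _] = set0) ?cards0 //.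
  by apply/setP=> v; rewrite !inE; apply/negP=> /and3P[_]; lia.
rewrite mulSn [X in _ <= X]addnC; apply: leq_trans (leq_add IH (leq_bin_central #|D| (lo + K))).
rewrite -cards_draws; apply: leq_trans (leq_of_leqif (leq_card_setU _ _)).
apply: subset_leq_card; apply/subsetP=> v; rewrite !inE.
by case: (v \subset D) => //=; lia.
Qed.

(** Fix the part of [c] outside [D]: then [E] is decided, and [R] confines the size of the part
    inside [D] to [K] consecutive values, each taken by at most a central binomial number of
    subsets. *)
Lemma card_window (D : {set T}) (K : nat) (R E : pred {set T}) (lo : {set T} -> nat) :
  (forall c, E c = E (c :\: D)) ->
  (forall c, R c -> lo (c :\: D) <= #|c :&: D| < lo (c :\: D) + K) ->
  #|[set c | R c && E c]| * 2 ^ #|D| <= K * 'C(#|D|, #|D|./2) * #|[set c | E c]|.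
Proof.
move=> ED RD.
have fib (G : pred {set T}) : #|[set c | G c]| =
    \sum_u #|[set c | G c && (c :\: D == u)]|.
  rewrite -sum1_card (partition_big (fun c => c :\: D) predT) //=.
  apply: eq_bigr => u _; rewrite -sum1_card; apply: eq_bigl => c.
  by rewrite !inE.
rewrite (fib (fun c => R c && E c)) (fib E) big_distrl big_distrr /=.
apply: leq_sum => u _.
have [/andP[Eu Du]|nu] := boolP (E u && [disjoint u & D]); last first.
  rewrite (_ : [set c | R c && E c && _] = set0) ?cards0 //.
  apply/setP=> c; rewrite !inE; apply/negP=> /andP[/andP[_ Ec] /eqP cu].
  case/negP: nu; rewrite -cu -ED Ec /=.
  by rewrite disjoints_subset setDE subsetIr.
have uD : u :\: D = u by apply/setDidPl.
apply: leq_mul.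
  apply: leq_trans (card_sized_window D (lo u) K).
  rewrite -[X in X <= _](card_in_imset (f := fun c => c :&: D)).
    apply: subset_leq_card; apply/subsetP=> _ /imsetP[c + ->].
    by rewrite !inE subsetIr => /andP[/andP[/RD + _] /eqP <-].
  move=> c c'; rewrite !inE => /andP[_ /eqP cu] /andP[_ /eqP cu'] cc.
  by rewrite -(setID c D) -(setID c' D) cc cu cu'.
rewrite -card_powerset -[X in X <= _](card_in_imset (f := fun v => v :|: u)).
  apply: subset_leq_card; apply/subsetP=> _ /imsetP[v + ->].
  rewrite powersetE !inE => vD; rewrite ED.
  have -> : (v :|: u) :\: D = u.
    by rewrite setDUl uD; move: vD; rewrite -setD_eq0 => /eqP ->; rewrite set0U.
  by rewrite Eu eqxx.
move=> v v'; rewrite !powersetE => vD vD' vv.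
have uD0 : u :&: D = set0 by apply/eqP; rewrite setI_eq0.
have := congr1 (fun X => X :&: D) vv; rewrite !setIUl uD0 !setU0.
by move: vD vD' => /setIidPl -> /setIidPl ->.
Qed.

Lemma card_window_le (D : {set T}) (K Q : nat) (R E : pred {set T}) (lo : {set T} -> nat) :
  (forall c, E c = E (c :\: D)) ->
  (forall c, R c -> lo (c :\: D) <= #|c :&: D| < lo (c :\: D) + K) ->
  K * 'C(#|D|, #|D|./2) * Q <= 2 ^ #|D| ->
  #|[set c | R c && E c]| * Q <= #|[set c | E c]|.
Proof.
move=> ED RD KQ; have h := card_window ED RD.
rewrite -(leq_pmul2r (_ : 0 < 2 ^ #|D|)) ?expn_gt0 //.
rewrite mulnAC; apply: leq_trans (leq_mul h (leqnn Q)) _.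
by rewrite mulnAC mulnC leq_mul2l KQ orbT.
Qed.

End AntiConcentration.

(** * Counting the colourings that admit a balanced path *)

Section CountingPaths.
Variables (F : fieldType) (n K B Q : nat).
Hypothesis B_gt1 : 1 < B.
Hypothesis KQ : forall m, 2 * B <= m -> K * 'C(m, m./2) * Q <= 2 ^ m.
Implicit Types (phi : formula F (n + n)) (W c : {set 'I_(n + n)}).

Lemma balanced_local W c c' : W :&: c = W :&: c' -> balanced K W c = balanced K W c'.
Proof.
move=> e; rewrite /balanced.
have D d : W :\: d = W :\: (W :&: d) by rewrite setDIr setDv set0U.
by rewrite (D c) (D c') e.
Qed.

Lemma balanced_path_local phi c c' : fvars phi :&: c = fvars phi :&: c' ->
  balanced_path K B phi c = balanced_path K B phi c'.
Proof.
have sub (V W : {set 'I_(n + n)}) : V \subset W -> W :&: c = W :&: c' -> V :&: c = V :&: c'.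
  by move=> /setIidPl VW e; rewrite -VW -!setIA e.
elim: phi => [i|x|a IHa b IHb|a IHa b IHb] /= e; rewrite (balanced_local e) //.
  by rewrite (IHa (sub _ _ (subsetUl _ _) e)) (IHb (sub _ _ (subsetUr _ _) e)).
by rewrite (IHa (sub _ _ (subsetUl _ _) e)) (IHb (sub _ _ (subsetUr _ _) e)).
Qed.

(** Balance puts [2 * #|W :&: c|] strictly between [#|W| - K] and [#|W| + K]; subtracting the part
    in [X] leaves a window of [K] counts on [W :\: X]. *)
Lemma balanced_window (X W c : {set 'I_(n + n)}) : X \subset W -> balanced K W c ->
  let lo := uphalf (#|W|.+1 - (K + 2 * #|X :&: c|)) in
  lo <= #|c :&: (W :\: X)| < lo + K.
Proof.
move=> XW; rewrite /balanced.
have e1 : #|W :&: c| = #|X :&: c| + #|c :&: (W :\: X)|.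
  rewrite -(cardsID X (W :&: c)) setIAC [W :&: X]setIC (setIidPl XW).
  by congr (_ + #|pred_of_set _|); rewrite setIDA setIC.
have e2 : #|W| = #|W :&: c| + #|W :\: c| by rewrite cardsID.
move: e1 e2; lia.
Qed.

(** [W] is the variable set at which the current scale began. Within a scale, induction on [phi]
    gives a union bound over children. Once at most half of [W] is left, the coins of the rest yield
    a factor [Q] and a new scale starts. A step loses at most half, so a quarter of [W] remains:
    hence [4 ^ j]. *)
Lemma count_balanced_path j phi W : fvars phi \subset W ->
  #|W| <= 4 * #|fvars phi| -> 4 ^ j * B <= #|W| ->
  #|[set c | balanced K W c && balanced_path K B phi c]| * Q ^ j
    <= fsize phi * 2 ^ (n + n).
Proof.
elim: j phi W => [|j IHj] phi W.
  move=> _ _ _; rewrite muln1; apply: leq_trans (max_card _) _.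
  rewrite -cardsT -powersetT card_powerset cardsT card_ord leq_pmull //.
  by case: phi.
(* Change of scale: [W :\: fvars psi] holds at least [2 * B] coins on which the path below does not
   depend. *)
have outer (psi : formula F (n + n)) : fvars psi \subset W -> #|W| <= 4 * #|fvars psi| ->
    2 * #|fvars psi| <= #|W| -> 4 ^ j.+1 * B <= #|W| ->
    #|[set c | balanced K W c && balanced_path K B psi c]| * Q ^ j.+1
      <= fsize psi * 2 ^ (n + n).
  move=> sub W4 W2 BW; have cD := cardsDS sub.
  have B4 : 0 < 4 ^ j by rewrite expn_gt0.
  have IH := IHj psi (fvars psi) (subxx _).
  rewrite expnS mulnA; apply: leq_trans (IH _ _).
  - rewrite leq_mul2r; apply/orP; right.
    have -> : [set c | balanced K (fvars psi) c && balanced_path K B psi c] =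
        [set c | balanced_path K B psi c].
      apply/setP=> c; rewrite !inE andb_idl //; exact: balanced_pathW.
    apply: (@card_window_le _ (W :\: fvars psi) K Q (balanced K W) _
      (fun u => uphalf (#|W|.+1 - (K + 2 * #|fvars psi :&: u|)))).
    + move=> c; apply: balanced_path_local.
      apply/setP=> i; rewrite !inE.
      by case: (i \in fvars psi).
    + move=> c /(balanced_window sub) /=.
      have -> // : fvars psi :&: (c :\: (W :\: fvars psi)) = fvars psi :&: c.
      by apply/setP=> i; rewrite !inE; case: (i \in fvars psi).
    apply: KQ; rewrite cD; move: BW; rewrite expnS; nia.
  - lia.
  by move: BW; rewrite expnS; lia.
have inner (psi : formula F (n + n)) (X : {set 'I_(n + n)}) : #|W| <= 2 * #|X| ->
    (#|W| <= 4 * #|fvars psi| ->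
       #|[set c | balanced K W c && balanced_path K B psi c]| * Q ^ j.+1
        <= fsize psi * 2 ^ (n + n)) ->
    #|[set c | balanced K W c && ((#|X| <= 2 * #|fvars psi|) && balanced_path K B psi c)]|
       * Q ^ j.+1 <= fsize psi * 2 ^ (n + n).
  move=> WX IH; have [Xp|Xp] := boolP (#|X| <= 2 * #|fvars psi|).
    by apply: IH; lia.
  rewrite (_ : [set _ | _] = set0) ?cards0 //.
  by apply/setP=> c; rewrite !inE andbF.
(* Stated for sums, this also serves products: size, variables and paths are computed alike. *)
have branch (a b : formula F (n + n)) (psi := FAdd a b) :
  (fvars a \subset W -> #|W| <= 4 * #|fvars a| ->
     #|[set c | balanced K W c && balanced_path K B a c]| * Q ^ j.+1
       <= fsize a * 2 ^ (n + n)) ->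
  (fvars b \subset W -> #|W| <= 4 * #|fvars b| ->
     #|[set c | balanced K W c && balanced_path K B b c]| * Q ^ j.+1
       <= fsize b * 2 ^ (n + n)) ->
  fvars psi \subset W -> #|W| <= 4 * #|fvars psi| -> 4 ^ j.+1 * B <= #|W| ->
  #|[set c | balanced K W c && balanced_path K B psi c]| * Q ^ j.+1
       <= fsize psi * 2 ^ (n + n).
  move=> IHa IHb sub W4 BW.
  have [W2|/ltnW W2] := leqP (2 * #|fvars psi|) #|W|; first exact: outer.
  have := sub; rewrite subUset => /andP[suba subb].
  have nB : (#|fvars a :|: fvars b| <= B) = false.
    apply/negbTE; rewrite -ltnNge; move: W2 BW; rewrite /psi /= expnS.
    have : 0 < 4 ^ j by rewrite expn_gt0.
    nia.
  have Ha := inner a _ W2 (IHa suba); have Hb := inner b _ W2 (IHb subb).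
  rewrite /= [X in _ <= X]mulSn [X in _ <= _ + X]mulnDl.
  apply: leq_trans (leq_addl _ _); apply: leq_trans (leq_add Ha Hb).
  rewrite -mulnDl leq_mul2r; apply/orP; right.
  apply: leq_trans (leq_of_leqif (leq_card_setU _ _)).
  apply: subset_leq_card; apply/subsetP=> c; rewrite !inE nB /=.
  by case: (balanced K W c) => //= /andP[_].
elim: phi => [i|e|a IHa b IHb|a IHa b IHb] sub W4 BW.
(* A leaf has at most one variable, whereas [1 < B] forces [#|W| > 4]. *)
- have : 0 < 4 ^ j by rewrite expn_gt0.
  by move: W4 BW; rewrite /= cards1 expnS; nia.
- have : 0 < 4 ^ j by rewrite expn_gt0.
  by move: W4 BW; rewrite /= cards0 expnS; nia.
- by apply: branch => // s4 w4; [apply: IHa | apply: IHb].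
by apply: (branch a b) => // s4 w4; [apply: IHa | apply: IHb].
Qed.

End CountingPaths.

(** * Choice of parameters *)

Section LowerBound.
Variables (F : fieldType) (n : nat).

(** List [c] first and its complement after it; the permutation is the position in this list. *)
Lemma partition_perm (c : {set 'I_(n + n)}) :
  #|c| = n -> exists A : {perm 'I_(n + n)}, c = [set i | A i < n].
Proof.
move=> cn; pose r := enum c ++ enum (~: c).
have ir i : i \in r by rewrite mem_cat !mem_enum inE orbN.
have sr : size r = n + n by rewrite size_cat -!cardE cardsC card_ord.
have lt i : index i r < n + n by move: (ir i); rewrite -index_mem sr.
have inj : injective (fun i => Ordinal (lt i)).
  by move=> i j /(congr1 val) /= /(congr1 (nth i r)); rewrite !nth_index.
exists (perm inj); apply/setP=> i; rewrite inE permE /= index_cat mem_enum.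
have sc : size (enum c) = n by rewrite -cardE.
case: (boolP (i \in c)) => ic.
  by move: ic; rewrite -mem_enum -index_mem sc => ->.
by rewrite sc ltnNge leq_addr.
Qed.

(** Full rank excludes the loss at every exact partition, so all ['C(n + n, n)] of them admit a
    balanced path, more than [count_balanced_path] allows. *)
Lemma full_max_rank_lower_bound (s j K B Q : nat) (f : {mpoly F[n + n]})
    (phi : formula F (n + n)) :
  1 < B -> 0 < K -> 2 * K <= B -> 4 ^ j * B <= n + n ->
  (forall m, 2 * B <= m -> K * 'C(m, m./2) * Q <= 2 ^ m) ->
  all_prods_ok s phi ->
  (fsize phi * 2 ^ (s * ps_depth phi)) ^ 2 < 2 ^ K ->
  fsize phi * (n + n).+1 < Q ^ j ->
  full_max_rank f -> feval phi <> f.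
Proof.
move=> B1 K0 KB jB KQ ok rk sz full fphi.
have frankE A : exists S, frank S A phi = 2 ^ n.
  by have [[S SE] _] := full A; exists S; rewrite /frank fphi.
have phiT : fvars phi = [set: 'I_(n + n)].
  have [S SE] := frankE 1%g; apply/eqP; rewrite eqEcard subsetT cardsT card_ord.
  have := frank_sqr S 1%g phi.
  by rewrite SE -expnM leq_exp2l // muln2 -addnn.
have unbal (c : {set 'I_(n + n)}) : #|c| = n -> balanced_path K B phi c.
  move=> /partition_perm[A ->]; apply/negPn/negP => nb; move: rk; rewrite ltnNge => /negP; apply.
  have [S SE] := frankE A; have := frank_le S KB ok nb.
  rewrite SE phiT cardsT card_ord -expnM muln2 -addnn mulnC.
  by rewrite leq_pmul2r ?expn_gt0.
have := count_balanced_path B1 KQ (subsetT (fvars phi)) _ _.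
move=> /(_ j); rewrite phiT cardsT card_ord leq_pmull // => /(_ isT jB) cnt.
have binle : 'C(n + n, n) <=
    #|[set c | balanced K setT c && balanced_path K B phi c]|.
  rewrite -[X in 'C(X, _)](card_ord (n + n)) -card_draws; apply: subset_leq_card.
  apply/subsetP=> c; rewrite !inE => /eqP cn; rewrite unbal // andbT.
  have cc : #|~: c| = n by have := cardsC c; rewrite cn card_ord; lia.
  rewrite /balanced setTI setTD cardsT card_ord cn cc minnn.
  by rewrite mul2n addnn -[X in X < _]addn0 ltn_add2l.
have : 4 ^ n * Q ^ j <= (n + n).+1 * (fsize phi * 2 ^ (n + n)).
  have := exp4_leq_bin n; rewrite mul2n -addnn => e4.
  apply: leq_trans (leq_mul e4 (leqnn _)) _; rewrite -mulnA leq_mul2l.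
  by rewrite (leq_trans _ cnt) ?orbT // leq_mul2r binle orbT.
have -> : 2 ^ (n + n) = 4 ^ n by rewrite addnn -mul2n expnM.
rewrite mulnA mulnC leq_pmul2r ?expn_gt0 // [_ * fsize _]mulnC leqNgt.
by rewrite sz.
Qed.

End LowerBound.

(** * Integer parameters for [n] between consecutive powers of [2 ^ 8] *)

Section Octaves.

(** After squaring, [bin_central_sqr] suffices, since [2 ^ (4 * h) <= m.+1]. *)
Lemma window_parameters h m :
  2 * 2 ^ (4 * h + 1) <= m -> 2 ^ h * 'C(m, m./2) * 2 ^ h <= 2 ^ m.
Proof.
move=> hm; rewrite -leq_sqr -[(2 ^ m) ^ 2]expnM mulnC [m * 2]mulnC expnM.
apply: leq_trans (bin_central_sqr m).
rewrite mulnA -expnD expnMn mulnC leq_mul2l; apply/orP; right.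
rewrite -expnM; apply: leq_trans (leqW hm); rewrite -expnS leq_exp2l //.
lia.
Qed.

Lemma expn_gt_quadratic h : 10 <= h -> 2 * h.+2 ^ 2 < 2 ^ h.
Proof.
move=> /subnK <-; elim: (h - 10) => [|i IH] //.
by rewrite addSn [2 ^ _.+1]expnS; move: IH; set x := 2 ^ (_ + _); rewrite -!mulnn; nia.
Qed.

Lemma octave n h0 : 2 ^ (8 * h0) <= n ->
  exists2 h, h0 <= h & 2 ^ (8 * h) <= n < 2 ^ (8 * h.+1).
Proof.
move=> hn; have n0 : 0 < n by apply: leq_trans hn; rewrite expn_gt0.
exists (trunc_log (2 ^ 8) n); last by rewrite !expnM; apply: trunc_log_bounds.
by apply: trunc_log_max => //; rewrite -expnM.
Qed.

Lemma full_max_rank_octave (F : fieldType) n s h (f : {mpoly F[n + n]})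
    (phi : formula F (n + n)) :
  11 <= h -> 2 ^ (8 * h) <= n < 2 ^ (8 * h.+1) ->
  fsize phi <= 2 ^ (h.+1 ^ 2) -> 4 * (s * ps_depth phi) <= 2 ^ h ->
  all_prods_ok s phi -> full_max_rank f -> feval phi <> f.
Proof.
move=> h11 /andP[nl nu] sz sd ok.
have h0 : 0 < h by apply: leq_trans h11.
(* There is room for [2 * h] scales, as [4 ^ (2 * h) * 2 ^ (4 * h + 1) = 2 ^ (8 * h + 1) <= n +
   n]. *)
apply: (@full_max_rank_lower_bound _ _ s (2 * h) (2 ^ h) (2 ^ (4 * h + 1)) (2 ^ h)).
- by rewrite -[X in X < _](expn0 2) ltn_exp2l // addn1.
- by rewrite expn_gt0.
- by rewrite -expnS leq_exp2l //; lia.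
- rewrite -[4]/(2 ^ 2) -expnM -expnD addnn -mul2n.
  apply: leq_trans (_ : 2 * 2 ^ (8 * h) <= _); last by rewrite leq_mul2l nl.
  by rewrite -expnS leq_exp2l //; lia.
- exact: window_parameters.
- exact: ok.
(* Size and sparsity each take half of the exponent [2 ^ h]; [expn_gt_quadratic] is applied at
   [h - 1 >= 10]. *)
- apply: leq_ltn_trans (_ : (2 ^ (h.+1 ^ 2 + s * ps_depth phi)) ^ 2 < _).
    by rewrite leq_sqr expnD leq_mul2r sz orbT.
  rewrite -expnM ltn_exp2l //; move: h0 h11 sd; case: h {nl nu sz} => // h _ h11 sd.
  by have := expn_gt_quadratic h11; move: sd; rewrite expnS; lia.
apply: leq_ltn_trans (_ : 2 ^ (h.+1 ^ 2) * 2 ^ (8 * h.+1 + 1) < _).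
  apply: leq_mul => //; rewrite addn1 expnS; lia.
(* [(h + 1)^2 + 8 (h + 1) + 1 < 2 h^2] holds from [h = 11] on. *)
rewrite -expnD -expnM ltn_exp2l //; rewrite -mulnn; nia.
Qed.

End Octaves.

(** * From the real-valued bounds to the integer ones *)

Section RealEstimates.
Local Open Scope R_scope.

Lemma INR_exp2 k : INR (2 ^ k)%N = 2 ^ k.
Proof.
elim: k => [|k IH] //.
by rewrite expnS -multE mult_INR IH.
Qed.

Lemma ln_octave n h : (0 < n)%N -> (n < 2 ^ (8 * h))%N ->
  0 <= ln (INR n) <= 8 * INR h * ln 2.
Proof.
move=> /ltP n0 /ltP nh; have n1 : 1 <= INR n by apply: (le_INR 1).
split.
  by rewrite -ln_1; case: n1 => [n1|<-]; [left; apply: ln_increasing; lra | right].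
have -> : 8 * INR h * ln 2 = ln (INR (2 ^ (8 * h))%N).
  rewrite INR_exp2 ln_pow; last lra.
  by rewrite -multE mult_INR /=; lra.
by left; apply: ln_increasing; [lra | apply: lt_INR].
Qed.

Lemma ln2_lt1 : 0 < ln 2 < 1.
Proof.
split; first by rewrite -ln_1; apply: ln_increasing; lra.
apply: exp_lt_inv; rewrite exp_ln; last lra.
by have := exp_ineq1 1; lra.
Qed.

(** [ln n <= 8 h ln 2] gives [(ln n)^2 / 64 <= h^2 (ln 2)^2], and [ln 2 < 1]. *)
Lemma size_bound_octave n h : (0 < n)%N -> (n < 2 ^ (8 * h))%N ->
  size_bound (1 / 64) n <= INR (2 ^ (h ^ 2))%N.
Proof.
move=> n0 nh; have [l0 lh] := ln_octave n0 nh; have [a0 a1] := ln2_lt1.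
rewrite /size_bound /Rpower INR_exp2 -Rpower_pow; last lra.
rewrite /Rpower -mulnn -multE mult_INR.
have hh : 0 <= INR h by apply: pos_INR.
set l := ln (INR n) in l0 lh *; set a := ln 2 in a0 a1 lh *; set x := INR h in lh hh *.
have le : 1 / 64 * l * l <= x * x * a.
  have : l * l <= (8 * x * a) * (8 * x * a) by apply: Rmult_le_compat.
  have : x * x * a * a <= x * x * a * 1.
    by apply: Rmult_le_compat_l; [apply: Rmult_le_pos; nra | lra].
  by lra.
by case: le => [lt|->]; [left; apply: exp_increasing | right].
Qed.

(** Here [n^(1/8) <= 2^(h + 1)], so the ratio bound [1 / 8] gives [k < 2^(h + 1) / 8]. *)
Lemma sd_octave n h k : (0 < n)%N -> (n < 2 ^ (8 * h.+1))%N ->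
  INR k / Rpower (INR n) (1 / 8) < 1 / 8 -> (4 * k <= 2 ^ h)%N.
Proof.
move=> n0 nh kn; have [l0 lh] := ln_octave n0 nh; have [a0 a1] := ln2_lt1.
have p0 : 0 < Rpower (INR n) (1 / 8) by apply: exp_pos.
have : INR k < 1 / 8 * Rpower (INR n) (1 / 8).
  apply: (Rmult_lt_reg_r (/ Rpower (INR n) (1 / 8))); first exact: Rinv_0_lt_compat.
  by rewrite Rmult_assoc Rinv_r ?Rmult_1_r //; lra.
have : Rpower (INR n) (1 / 8) <= 2 ^ h.+1.
  rewrite -Rpower_pow; last lra.
  rewrite /Rpower; have le : 1 / 8 * ln (INR n) <= INR h.+1 * ln 2 by lra.
  by case: le => [lt|->]; [left; apply: exp_increasing | right].
rewrite /= => r1 r2; apply/leP/INR_le.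
rewrite -multE mult_INR INR_exp2 /=; lra.
Qed.

End RealEstimates.

Theorem theorem7 :
  exists eps : R, Rpositive eps /\
  forall (F : fieldType) (s d : nat -> nat),
    sd_little_o s d ->
    exists N : nat, forall n : nat, (N <= n)%N ->
      forall (f : {mpoly F[n + n]}), full_max_rank f ->
      forall phi : formula F (n + n),
        product_sparse (s n) (d n) phi ->
        size_at_most phi (size_bound eps n) ->
        feval phi <> f.
Proof.
exists (Rdiv 1 64); split; first by rewrite /Rpositive; lra.
move=> F s d /(_ (Rdiv 1 8)) [|N1 sdN]; first lra.
(* The second bound makes the octave of [n] satisfy [11 <= h]. *)
exists (maxn N1 (2 ^ (8 * 11))) => n; rewrite geq_max => /andP[/leP nN1 n11].
move=> f full phi [ok dE] sz.
have [h h11 /andP[nl nu]] := octave n11.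
have n0 : 0 < n by apply: leq_trans nl; rewrite expn_gt0.
apply: (@full_max_rank_octave F n (s n) h) => //; first by rewrite nl.
  apply/leP/INR_le; apply: Rle_trans sz _; exact: size_bound_octave.
rewrite dE; apply: (sd_octave n0 nu).
have := sdN n nN1; rewrite /R_dist Rminus_0_r => lt.
exact: Rle_lt_trans (Rle_abs _) lt.
Qed.
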